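(* Let $p\in[2,\infty)$. The function $$g(x)=\frac{\log(x/\sin_p(x))}{\log(\cosh_p(x))}$$ is strictly increasing in $x\in(0,\pi_p/2)$. In particular, for all $x\in(0,\pi_p/2)$, $$\frac{1}{\cosh_p(x)^\beta}<\frac{\sin_p(x)}{x}<\frac{1}{\cosh_p(x)^\alpha},$$ where $$\alpha=\frac{1}{1+p}\quad\text{and}\quad \beta=\frac{\log(\pi_p/2)}{\log(\cosh_p(\pi_p/2))}$$ are the best possible constants (that is, $\alpha$ is the largest and $\beta$ the smallest real constant for which the respective inequality holds for all $x\in(0,\pi_p/2)$).
   Context: Let $p>1$. Define $\arcsin_p:[0,1]\to[0,\pi_p/2]$ by $\arcsin_p(x)=\int_0^x(1-t^p)^{-1/p}\,dt$, where $\pi_p/2:=\arcsin_p(1)=\int_0^1(1-t^p)^{-1/p}\,dt$. This is an increasing homeomorphism; its inverse is the generalized sine function $\sin_p:[0,\pi_p/2]\to[0,1]$. For $x\in(0,\infty)$ define $\operatorname{arsinh}_p(x)=\int_0^x(1+t^p)^{-1/p}\,dt$; its inverse is the generalized hyperbolic sine function $\sinh_p:(0,\infty)\to(0,\infty)$. The generalized hyperbolic cosine is $\cosh_p(x)=\frac{d}{dx}\sinh_p(x)$, so that $\cosh_p(x)^p-\sinh_p(x)^p=1$ for $x>0$. *)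

(* Defs.v *)
From HB Require Import structures.
From mathcomp Require Import all_boot all_order all_algebra.
From mathcomp Require Import all_classical all_reals all_analysis.
Import Order.TTheory GRing.Theory Num.Theory.
Import numFieldNormedType.Exports.

Set Implicit Arguments.
Unset Strict Implicit.
Unset Printing Implicit Defensive.

Local Open Scope classical_set_scope.
Local Open Scope ring_scope.

(* At t = 1 the base of the power vanishes and 0 `^ (- p^-1) = 0; this single
   point is Lebesgue-negligible, so [arcsin_p p 1] is the value of the
   improper integral. *)
Definition arcsin_p {R : realType} (p x : R) : R :=
  \int[lebesgue_measure]_(t in `[0, x]) (1 - t `^ p) `^ (- p^-1).

Definition pi_p {R : realType} (p : R) : R := 2 * arcsin_p p 1.

(* [sin_p p] is only meaningful on [0, pi_p p / 2]; off the image of [0, 1]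
   under [arcsin_p p] it takes the junk value 0. *)
Definition sin_p {R : realType} (p : R) : R -> R :=
  'pinv_(fun=> 0) `[0, 1] (arcsin_p p).

Definition arsinh_p {R : realType} (p x : R) : R :=
  \int[lebesgue_measure]_(t in `[0, x]) (1 + t `^ p) `^ (- p^-1).

(* [sinh_p p] and [cosh_p p] are only meaningful on ]0, +oo[. *)
Definition sinh_p {R : realType} (p : R) : R -> R :=
  'pinv_(fun=> 0) `]0, +oo[ (arsinh_p p).

Definition cosh_p {R : realType} (p : R) : R -> R := (sinh_p p)^`()%classic.

(* Main.v *)
(** By the monotone form of l'Hopital's rule, a quotient F/G of functions
    vanishing at 0+ increases strictly when F'/G' does, and F/G < F'/G'.
    For g the quotient of derivatives factors as
      (sin_p x - x cos_p x) / (x^p sin_p x) * (x / tanh_p x)^(p-1),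
    and both factors increase by the same rule: x / tanh_p x because
    1 / tanh_p' = cosh_p^p, and the first one because its quotient of
    derivatives is 1 / (t^(p-2) (p + t)) with t = x / tan_p x, which decreases
    since tan_p' = cos_p^(-p) increases; here p >= 2 is needed.  The resulting
    bounds
      1/(1+p) < g < (cosh_p^p)^(p-1) / ((cos_p^p)^(p-2) (p + cos_p^p))
    give the limit 1/(1+p) at 0, and beta is the limit of g at pi_p/2. *)

Require Import Defs.
From HB Require Import structures.
From mathcomp Require Import all_boot all_order all_algebra.
From mathcomp Require Import all_classical all_reals all_analysis.
From mathcomp Require Import measurable_realfun ring lra.
Import Order.TTheory GRing.Theory Num.Theory.
Import numFieldNormedType.Exports.

Set Implicit Arguments.
Unset Strict Implicit.
Unset Printing Implicit Defensive.

Local Open Scope classical_set_scope.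
Local Open Scope ring_scope.

(** * Differentiation rules in [is_derive] form *)

Section real_derivatives.
Context {R : realType}.
Implicit Types (f g : R -> R) (x df dg : R).

Lemma is_derive_cvg f x df : is_derive x 1 f df -> {for x, continuous f}.
Proof. by move=> [dfx _]; exact/differentiable_continuous/derivable1_diffP. Qed.

Lemma is_derive_mul f g x df dg : is_derive x 1 f df -> is_derive x 1 g dg ->
  is_derive x 1 (fun y => f y * g y) (df * g x + f x * dg).
Proof.
move=> fd gd; apply: (is_derive_eq (is_deriveM fd gd)).
by rewrite addrC [df * _]mulrC.
Qed.

Lemma is_derive_shift k f x df : is_derive x 1 f df ->
  is_derive x 1 (fun y => k + f y) df.
Proof.
move=> fd; rewrite -[df]add0r.
exact: (@is_deriveD _ _ _ (cst k) f x 1 0 df _ fd).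
Qed.

Lemma is_derive_sub f g x df dg : is_derive x 1 f df -> is_derive x 1 g dg ->
  is_derive x 1 (fun y => f y - g y) (df - dg).
Proof. by move=> fd gd; exact: (is_deriveB fd gd). Qed.

Lemma is_derive_scale k f x df : is_derive x 1 f df ->
  is_derive x 1 (fun y => k * f y) (k * df).
Proof. by move=> fd; exact: (is_deriveZ k fd). Qed.

Lemma is_derive_div f g x df dg : g x != 0 ->
  is_derive x 1 f df -> is_derive x 1 g dg ->
  is_derive x 1 (fun y => f y / g y) ((df * g x - f x * dg) / (g x) ^+ 2).
Proof.
move=> gx fd gd; apply: (is_derive_eq (is_derive_mul fd (is_deriveV gx gd))).
by rewrite /GRing.scale/=; field.
Qed.

Lemma is_derive_powR r f x df : 0 < f x -> is_derive x 1 f df ->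
  is_derive x 1 (fun y => f y `^ r) (r * f x `^ (r - 1) * df).
Proof. by move=> fx fd; exact: (is_derive1_comp (is_derive1_powR r fx) fd). Qed.

Lemma is_derive_ln f x df : 0 < f x -> is_derive x 1 f df ->
  is_derive x 1 (fun y => ln (f y)) (df / f x).
Proof.
move=> fx fd; apply: (is_derive_eq (is_derive1_comp (is_derive1_ln fx) fd)).
by rewrite mulrC.
Qed.

End real_derivatives.

(** * The monotone form of l'Hopital's rule at 0 from the right *)

Section monotone_lhopital.
Context {R : realType}.
Implicit Types (F G dF dG : R -> R) (L : R).

Lemma is_derive_gt0_lt F dF (a b x y : R) :
  (forall z : R, a < z < b -> is_derive z 1 F (dF z)) ->
  (forall z : R, a < z < b -> x < z -> z < y -> 0 < dF z) ->
  a < x -> x < y -> y < b -> F x < F y.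
Proof.
move=> Fd dF0 ax xy yb.
have xyab z : x <= z <= y -> a < z < b by move=> /andP[xz zy]; lra.
have [z /[!in_itv]/= /andP[xz zy] FE] : exists2 z, z \in `]x, y[%R &
    F y - F x = dF z * (y - x).
  apply: MVT => // [z /[!in_itv]/= /andP[xz zy]|].
    by apply: Fd; lra.
  apply: continuous_in_subspaceT => z /[!inE]/=/[!in_itv]/= xzy.
  exact: is_derive_cvg (Fd _ (xyab _ xzy)).
rewrite -subr_gt0 FE mulr_gt0 ?subr_gt0// dF0//; lra.
Qed.

(** [F] increases on []0, x]] from its limit 0. Positivity of the derivative is asked only to the
    left of [x], so that [F] may contain a constant depending on [x], such as [r x] in
    [lhopital_incr_lt]. *)
Lemma is_derive_gt0 F dF L :
  (forall x : R, 0 < x < L -> is_derive x 1 F (dF x)) ->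
  F x @[x --> 0^'+] --> 0 -> forall x : R, 0 < x < L ->
  (forall z : R, 0 < z -> z < x -> 0 < dF z) -> 0 < F x.
Proof.
(* The limit at 0 only yields [0 <= F (x / 2)]; the increase from [x / 2] to [x] restores
   strictness. *)
move=> Fd F0 x /andP[x0 xL] dF0; apply: (@le_lt_trans _ _ (F (x / 2))).
  apply: (cvgr_to_le F0); near=> y; apply/ltW.
  apply: (is_derive_gt0_lt Fd) => //; last 2 first.
  - near: y; apply: nbhs_right_lt; lra.
  - lra.
  - move=> z /andP[z0 zL] _ zx; apply: dF0 => //; lra.
apply: (is_derive_gt0_lt Fd) => //; last 2 first.
- lra.
- lra.
- by move=> z /andP[z0 zL] _ zx; apply: dF0.
Unshelve. all: by end_near. Qed.

Section quotients.
Variables (F G dG r : R -> R) (L : R).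
(** Here [r] is the quotient of the derivatives, encoded without division as a factor of the
    derivative of [F]. *)
Hypothesis Fd : forall x : R, 0 < x < L -> is_derive x 1 F (r x * dG x).
Hypothesis Gd : forall x : R, 0 < x < L -> is_derive x 1 G (dG x).
Hypothesis dG0 : forall x : R, 0 < x < L -> 0 < dG x.
Hypothesis F0 : F x @[x --> 0^'+] --> 0.
Hypothesis G0 : G x @[x --> 0^'+] --> 0.

Lemma lhopital_denominator_gt0 x : 0 < x < L -> 0 < G x.
Proof.
move=> xL; apply: (is_derive_gt0 Gd G0 xL) => z z0 zx; apply: dG0; lra.
Qed.

(** [F - k * G] vanishes at 0 and has derivative [(r - k) * dG > 0]. *)
Lemma lhopital_gt k : (forall x, 0 < x < L -> k < r x) ->
  forall x, 0 < x < L -> k < F x / G x.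
Proof.
move=> kr x xL; rewrite ltr_pdivlMr ?lhopital_denominator_gt0// -subr_gt0.
pose H := fun y => F y - k * G y.
rewrite -[X in 0 < X]/(H x).
apply: (@is_derive_gt0 H (fun y => r y * dG y - k * dG y) L) => //.
- by move=> y yL; exact: is_derive_sub (Fd yL) (is_derive_scale k (Gd yL)).
- by have := cvgB F0 (cvgM (cvg_cst k) G0); rewrite mulr0 subrr; apply.
- move=> z z0 zx; have zL : 0 < z < L by lra.
  by rewrite -mulrBl mulr_gt0 ?dG0// subr_gt0 kr.
Qed.

Hypothesis r_incr : forall x y : R, 0 < x -> x < y -> y < L -> r x < r y.

(** For fixed [x], the function [r x * G - F] vanishes at 0, and its derivative [(r x - r z) * dG z]
    is positive for [z < x]. *)
Lemma lhopital_incr_lt x : 0 < x < L -> F x / G x < r x.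
Proof.
move=> xL; rewrite ltr_pdivrMr ?lhopital_denominator_gt0// -subr_gt0.
pose H := fun y => r x * G y - F y.
rewrite -[X in 0 < X]/(H x).
apply: (@is_derive_gt0 H (fun y => r x * dG y - r y * dG y) L) => //.
- by move=> y yL; exact: is_derive_sub (is_derive_scale (r x) (Gd yL)) (Fd yL).
- by have := cvgB (cvgM (cvg_cst (r x)) G0) F0; rewrite mulr0 subrr; apply.
- move=> z z0 zx; have zL : 0 < z < L by lra.
  by rewrite -mulrBl mulr_gt0 ?dG0// subr_gt0 r_incr//; lra.
Qed.

(** With [k = r x] fixed, [F - k * G] increases from [x] to [y]. It is negative at [x] by
    [lhopital_incr_lt], so dividing by the larger [G y] instead of [G x] only raises it. *)
Lemma lhopital_incr x y : 0 < x -> x < y -> y < L -> F x / G x < F y / G y.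
Proof.
move=> x0 xy yL; have xL : 0 < x < L by lra.
have Gx := lhopital_denominator_gt0 xL.
have Gxy : G x < G y.
  by apply: (is_derive_gt0_lt Gd) => // z zL _ _; exact: dG0.
have := lhopital_incr_lt xL; rewrite ltr_pdivrMr// => FGk.
have FGxy : F x - r x * G x < F y - r x * G y.
  apply: (@is_derive_gt0_lt (fun y => F y - r x * G y)
    (fun y => r y * dG y - r x * dG y) 0 L) => //.
  - by move=> z zL; exact: is_derive_sub (Fd zL) (is_derive_scale (r x) (Gd
      zL)).
  - move=> z zL xz zy; rewrite -mulrBl mulr_gt0 ?dG0// subr_gt0 r_incr//; lra.
rewrite ltr_pdivrMr// mulrAC ltr_pdivlMr; last lra.
(* The two positive products add up to [F y * G x - F x * G y]. *)
have : 0 < (G y - G x) * (r x * G x - F x) by rewrite mulr_gt0//; lra.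
have : 0 < (F y - r x * G y - (F x - r x * G x)) * G x by rewrite mulr_gt0//;
  lra.
lra.
Qed.

End quotients.

End monotone_lhopital.

(** * Limits of real powers *)

Section powR_limits.
Context {R : realType} {T : Type} {F : set_system T} {FF : Filter F}.
Implicit Types f : T -> R.

Lemma cvg_powR f (a r : R) : 0 < a ->
  f x @[x --> F] --> a -> f x `^ r @[x --> F] --> a `^ r.
Proof.
move=> a0 fa; apply: (@cvg_comp _ _ _ f (fun y : R => y `^ r) _ _ _ fa).
exact: (is_derive_cvg (is_derive1_powR r a0)).
Qed.

(** [powR_cvg0] is a one-sided limit, so [f] has to approach 0 through positive values. *)
Lemma cvg_powR0 f (r : R) : 0 < r -> (\forall x \near F, 0 < f x) ->
  f x @[x --> F] --> 0 -> f x `^ r @[x --> F] --> 0.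
Proof.
move=> r0 fgt0 f0; apply: (@cvg_comp _ _ _ f (fun y :
  R => y `^ r) _ _ _ _ (powR_cvg0 r0)).
by move=> A /f0; apply: filterS2 fgt0 => x fx; apply.
Qed.

End powR_limits.

(** * Cosine and tangent, circular and hyperbolic at once, as functions of the sine *)

Section generalized_cosine.
Context {R : realType}.
Implicit Types (p sg x : R) (s : R -> R).

(* [sg = -1] gives cos_p as a function of sin_p, and [sg = 1] gives cosh_p as a
   function of sinh_p. *)
Definition gcos p sg (s : R) : R := (1 + sg * s `^ p) `^ p^-1.

Lemma gcos_gt0 p sg (s : R) : 0 < 1 + sg * s `^ p -> 0 < gcos p sg s.
Proof. exact: powR_gt0. Qed.

Lemma gcos_powR p sg (s : R) : 0 < p -> 0 < 1 + sg * s `^ p ->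
  gcos p sg s `^ p = 1 + sg * s `^ p.
Proof.
by move=> p0 u0; rewrite -powRrM mulVf ?gt_eqF// powRr1// ltW.
Qed.

(** The only input is the differential equation s' = c shared by sin_p and sinh_p. Differentiating
    c^p = 1 + sg s^p gives c^(p-1) c' = sg s^(p-1) c. *)
Lemma is_derive_gcos p sg s x : 0 < p -> 0 < s x -> 0 < 1 + sg * s x `^ p ->
  is_derive x 1 s (gcos p sg (s x)) ->
  is_derive x 1 (fun y => gcos p sg (s y))
    (sg * s x `^ (p - 1) * gcos p sg (s x) `^ (2 - p)).
Proof.
move=> p0 sx0 u0 sd.
have ud : is_derive x 1 (fun y => 1 + sg * s y `^ p)
    (sg * (p * s x `^ (p - 1) * gcos p sg (s x))).
  exact: is_derive_shift (is_derive_scale sg (is_derive_powR p sx0 sd)).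
have := @is_derive_powR _ p^-1 (fun y => 1 + sg * s y `^ p) _ _ u0 ud.
rewrite -[fun y => _]/(fun y => gcos p sg (s y)) => /is_derive_eq; apply.
have c0 := gcos_gt0 u0.
have -> : 2 - p = (1 - p) + 1 by ring.
rewrite (@powRD _ (gcos p sg (s x))); last by rewrite (gt_eqF c0) implybT.
rewrite powRr1 ?(ltW c0)// [X in _ = _ * (X * _)](_ : _ =
  (1 + sg * s x `^ p) `^ (p^-1 - 1)).
  by field; rewrite gt_eqF.
by rewrite /gcos -powRrM mulrBr mulr1 mulVf// gt_eqF.
Qed.

(** The quotient rule gives 1 - s c' / c^2 = 1 - sg s^p / c^p, which is 1 / c^p since c^p - sg s^p =
    1. *)
Lemma is_derive_gtan p sg s x : 0 < p -> 0 < s x -> 0 < 1 + sg * s x `^ p ->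
  is_derive x 1 s (gcos p sg (s x)) ->
  is_derive x 1 (fun y => s y / gcos p sg (s y)) (1 + sg * s x `^ p)^-1.
Proof.
move=> p0 sx0 u0 sd; have c0 := gcos_gt0 u0.
have := @is_derive_div _ s (fun y => gcos p sg (s y)) _ _ _ (lt0r_neq0 c0) sd
  (is_derive_gcos p0 sx0 u0 sd).
move/is_derive_eq; apply.
rewrite (@powRB _ (gcos p sg (s x))); last by rewrite (gt_eqF c0) implybT.
rewrite gcos_powR// (powR_mulrn 2) ?(ltW c0)//.
have -> : s x * (sg * s x `^ (p - 1) * (gcos p sg (s x) ^+ 2 /
  (1 + sg * s x `^ p))) = sg * (s x * s x `^ (p - 1)) *
  (gcos p sg (s x) ^+ 2 / (1 + sg * s x `^ p)) by ring.
rewrite mulr_powRB1 ?ltW//; field.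
by rewrite (gt_eqF u0) (gt_eqF c0).
Qed.

Lemma cvg_gcos {T : Type} {F : set_system T} {FF : Filter F} p sg (s : T -> R) :
  0 < p -> (\forall x \near F, 0 < s x) ->
  s x @[x --> F] --> 0 -> gcos p sg (s x) @[x --> F] --> (1 : R).
Proof.
move=> p0 s0 scvg.
have : 1 + sg * s x `^ p @[x --> F] --> 1 + sg * 0.
  by apply: cvgD; [exact: cvg_cst|apply: cvgM;
    [exact: cvg_cst|exact: cvg_powR0]].
by rewrite mulr0 addr0 => /(cvg_powR (r := p^-1) ltr01); rewrite powR1.
Qed.

End generalized_cosine.

(** * Monotonicity, lower bound and limit at 0 of the logarithmic quotient *)

Section sine_sinh_ratio.
Context {R : realType}.
(** [s] and [S] stand for sin_p and sinh_p on []0, L[]. Only signs, the equations s' = c and S' = C,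
    and the limits at 0 enter; the integrals behind them do not. *)
Variables (p L : R) (s S : R -> R).
Hypothesis p2 : 2 <= p.
Hypothesis s01 : forall x : R, 0 < x < L -> 0 < s x < 1.
Hypothesis S0 : forall x : R, 0 < x < L -> 0 < S x.
Hypothesis sd : forall x : R, 0 < x < L -> is_derive x 1 s (gcos p (-1) (s x)).
Hypothesis Sd : forall x : R, 0 < x < L -> is_derive x 1 S (gcos p 1 (S x)).
Hypothesis s_cvg0 : s x @[x --> 0^'+] --> 0.
Hypothesis S_cvg0 : S x @[x --> 0^'+] --> 0.
Hypothesis L0 : 0 < L.

Let c (x : R) := gcos p (-1) (s x).
Let C (x : R) := gcos p 1 (S x).

Let p0 : 0 < p. Proof. by apply: lt_le_trans p2. Qed.

Let s0 (x : R) : 0 < x < L -> 0 < s x. Proof. by move=> /s01/andP[]. Qed.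

Let near0L : \forall x \near 0^'+, 0 < x < L.
Proof.
have := nbhs_right_lt L0; apply: filterS2 (nbhs_right_gt 0) => x x0 xL.
by rewrite x0.
Qed.

Let near_s0 : \forall x \near 0^'+, 0 < s x.
Proof. by apply: filterS near0L => x; exact: s0. Qed.

Let near_S0 : \forall x \near 0^'+, 0 < S x.
Proof. by apply: filterS near0L => x; exact: S0. Qed.

Let sp01 (x : R) : 0 < x < L -> 0 < s x `^ p < 1.
Proof.
move=> /s01/andP[sx0 sx1]; rewrite powR_gt0//=.
have := @gt0_ltr_powR _ p p0 (s x) 1.
rewrite powR1; apply => //; rewrite nnegrE; lra.
Qed.

Let Sp0 (x : R) : 0 < x < L -> 0 < S x `^ p.
Proof. by move=> /S0; exact: powR_gt0. Qed.

Let u0 (x : R) : 0 < x < L -> 0 < 1 + -1 * s x `^ p.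
Proof. by move=> /sp01; lra. Qed.

Let U0 (x : R) : 0 < x < L -> 0 < 1 + 1 * S x `^ p.
Proof. by move=> /Sp0; lra. Qed.

Let c0 (x : R) : 0 < x < L -> 0 < c x.
Proof. by move=> /u0; exact: gcos_gt0. Qed.

Let C0 (x : R) : 0 < x < L -> 0 < C x.
Proof. by move=> /U0; exact: gcos_gt0. Qed.

Let c1 (x : R) : 0 < x < L -> c x < 1.
Proof.
move=> xL; rewrite ltNge; apply/negP => c1.
have : 1 `^ p <= c x `^ p.
  by apply: ge0_ler_powR; rewrite ?nnegrE ?(ltW p0) ?(ltW (c0 xL)).
rewrite powR1 gcos_powR//; last exact: u0.
by have := sp01 xL; lra.
Qed.

Let s_incr (x y : R) : 0 < x -> x < y -> y < L -> s x < s y.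
Proof.
by apply: (is_derive_gt0_lt sd) => z zL _ _; exact: c0.
Qed.

Let S_incr (x y : R) : 0 < x -> x < y -> y < L -> S x < S y.
Proof.
by apply: (is_derive_gt0_lt Sd) => z zL _ _; exact: C0.
Qed.

Let sp_incr (x y : R) : 0 < x -> x < y -> y < L -> s x `^ p < s y `^ p.
Proof.
move=> x0 xy yL; apply: gt0_ltr_powR => //;
  rewrite ?nnegrE ?s_incr// ltW// s0//; lra.
Qed.

Let Sp_incr (x y : R) : 0 < x -> x < y -> y < L -> S x `^ p < S y `^ p.
Proof.
move=> x0 xy yL; apply: gt0_ltr_powR => //;
  rewrite ?nnegrE ?S_incr// ltW// S0//; lra.
Qed.

Let c_cvg : c x @[x --> 0^'+] --> (1 : R).
Proof. exact: cvg_gcos. Qed.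

Let C_cvg : C x @[x --> 0^'+] --> (1 : R).
Proof. exact: cvg_gcos. Qed.

Let id_cvg0 : x @[x --> (0 : R)^'+] --> (0 : R).
Proof. exact: cvg_at_right_filter. Qed.

Let tan_cvg : s x / c x @[x --> 0^'+] --> 0.
Proof.
have := cvgM s_cvg0 (cvgV (oner_neq0 R) c_cvg).
by rewrite mul0r; apply.
Qed.

Let tanh_cvg : S x / C x @[x --> 0^'+] --> 0.
Proof.
have := cvgM S_cvg0 (cvgV (oner_neq0 R) C_cvg).
by rewrite mul0r; apply.
Qed.

Let tan' (x : R) := (1 + -1 * s x `^ p)^-1.
Let tanh' (x : R) := (1 + 1 * S x `^ p)^-1.

(** The factor 1 is the derivative of the identity: this is the shape [r x * dG x] needed for the
    quotient tan_p x / x. *)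
Let tand (x : R) : 0 < x < L ->
  is_derive x 1 (fun y => s y / c y) (tan' x * 1).
Proof. by move=> xL; rewrite mulr1; apply: is_derive_gtan => //;
  [exact: s0|exact: u0|exact: sd]. Qed.

Let tanhd (x : R) : 0 < x < L -> is_derive x 1 (fun y => S y / C y) (tanh' x).
Proof. by move=> xL; apply: is_derive_gtan => //;
  [exact: S0|exact: U0|exact: Sd]. Qed.

Let idd (x : R) : 0 < x < L -> is_derive x 1 (fun y : R => y) 1.
Proof. by move=> _; exact: is_derive_id. Qed.

Let tanh'0 (x : R) : 0 < x < L -> 0 < tanh' x.
Proof. by move=> /U0; rewrite invr_gt0. Qed.

(** The derivative 1 is split as [r * dG] for the quotient x / tanh_p x, with [r = 1 / tanh']. *)
Let idd' (x : R) : 0 < x < L ->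
  is_derive x 1 (fun y : R => y) ((1 + 1 * S x `^ p) * tanh' x).
Proof. by move=> xL; rewrite divff ?gt_eqF ?U0//; exact: is_derive_id. Qed.

Let tan'_incr (x y : R) : 0 < x -> x < y -> y < L -> tan' x < tan' y.
Proof.
move=> x_gt0 xy yL; rewrite /tan' ltf_pV2 ?posrE; try (apply: u0; lra).
by have := sp_incr x_gt0 xy yL; lra.
Qed.

Let U_incr (x y : R) : 0 < x -> x < y -> y < L ->
  1 + 1 * S x `^ p < 1 + 1 * S y `^ p.
Proof. by move=> x_gt0 xy yL; have := Sp_incr x_gt0 xy yL; lra. Qed.

Let tanx_incr (x y : R) : 0 < x -> x < y -> y < L ->
  s x / c x / x < s y / c y / y.
Proof.
exact: (lhopital_incr tand idd (fun _ _ => ltr01) tan_cvg id_cvg0 tan'_incr).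
Qed.

Let tanx_lt (x : R) : 0 < x < L -> s x / c x / x < tan' x.
Proof.
exact: (lhopital_incr_lt tand idd (fun _ _ => ltr01) tan_cvg id_cvg0 tan'_incr).
Qed.

Let tanx_gt (x : R) : 0 < x < L -> 1 < s x / c x / x.
Proof.
apply: (lhopital_gt tand idd (fun _ _ => ltr01) tan_cvg id_cvg0) => y yL.
rewrite invf_gt1 ?u0//; have := sp01 yL; lra.
Qed.

Let xtanh_incr (x y : R) : 0 < x -> x < y -> y < L ->
  x / (S x / C x) < y / (S y / C y).
Proof. exact: (lhopital_incr idd' tanhd tanh'0 id_cvg0 tanh_cvg U_incr). Qed.

Let xtanh_lt (x : R) : 0 < x < L -> x / (S x / C x) < 1 + 1 * S x `^ p.
Proof. exact: (lhopital_incr_lt idd' tanhd tanh'0 id_cvg0 tanh_cvg U_incr). Qed.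

Let xtanh_gt (x : R) : 0 < x < L -> 1 < x / (S x / C x).
Proof.
apply: (lhopital_gt idd' tanhd tanh'0 id_cvg0 tanh_cvg) => y yL.
have := Sp0 yL; lra.
Qed.

Let t x := x * c x / s x.

Let t_inv (x : R) : 0 < x < L -> t x = (s x / c x / x)^-1.
Proof.
move=> xL; rewrite /t; field.
rewrite (gt_eqF (s0 xL)) (gt_eqF (c0 xL)) gt_eqF//; lra.
Qed.

(** These are the reciprocals of 1 < tan_p x / x < tan_p' x; the lower bound is cos_p^p. *)
Let t01 (x : R) : 0 < x < L -> 1 + -1 * s x `^ p < t x < 1.
Proof.
move=> xL; have t1 := tanx_gt xL; rewrite t_inv//; apply/andP; split.
  rewrite -[X in X < _]invrK ltf_pV2 ?posrE ?tanx_lt ?invr_gt0 ?u0//; lra.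
rewrite invf_lt1//; lra.
Qed.

Let t0 (x : R) : 0 < x < L -> 0 < t x.
Proof. by move=> xL; have := t01 xL; have := u0 xL; lra. Qed.

Let t_decr (x y : R) : 0 < x -> x < y -> y < L -> t y < t x.
Proof.
move=> x_gt0 xy yL.
have xL : 0 < x < L by lra. have yL' : 0 < y < L by lra.
rewrite !t_inv// ltf_pV2 ?posrE ?tanx_incr//.
  have := tanx_gt yL'; lra.
have := tanx_gt xL; lra.
Qed.

(* [A = sin_p - x cos_p] and [B = x^p sin_p] below satisfy
   [A' / B' = 1 / (t^(p - 2) (p + t))] with [t = x cot_p x]. *)
Let den (r : R) : R := r `^ (p - 2) * (p + r).

(** [2 <= p] makes the power weakly increasing; strictness comes from the factor [p + r], as the
    power is constant when [p = 2]. *)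
Let den_incr r r' : 0 < r -> r < r' -> den r < den r'.
Proof.
move=> r0 rr'; rewrite /den.
apply: (@le_lt_trans _ _ (r' `^ (p - 2) * (p + r))).
  rewrite ler_wpM2r//; first by have := p0; lra.
  by apply: ge0_ler_powR; rewrite ?subr_ge0 ?nnegrE// ltW//;
    exact: lt_trans rr'.
by rewrite ltr_pM2l ?ltrD2l//; apply: powR_gt0; exact: lt_trans rr'.
Qed.

Let den_gt0 r : 0 < r -> 0 < den r.
Proof.
by move=> r0; rewrite /den mulr_gt0 ?powR_gt0// addr_gt0.
Qed.

Let den1 : den 1 = 1 + p.
Proof. by rewrite /den powR1 mul1r addrC. Qed.

Let A (x : R) := s x - x * c x.
Let B (x : R) := x `^ p * s x.
Let B' (x : R) := p * x `^ (p - 1) * s x + x `^ p * c x.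

Let Bd (x : R) : 0 < x < L -> is_derive x 1 B (B' x).
Proof.
move=> /[dup] xL /andP[x_gt0 _].
have := is_derive_mul (is_derive1_powR p x_gt0) (sd xL).
by move/is_derive_eq; apply.
Qed.

Let B'_gt0 (x : R) : 0 < x < L -> 0 < B' x.
Proof.
move=> /[dup] xL /andP[x_gt0 _]; rewrite addr_gt0//.
  by rewrite !mulr_gt0 ?powR_gt0 ?s0.
by apply: mulr_gt0; [exact: powR_gt0|exact: c0].
Qed.

Let A_cvg0 : A x @[x --> 0^'+] --> 0.
Proof.
have := cvgB s_cvg0 (cvgM id_cvg0 c_cvg).
by rewrite mul0r subr0; apply.
Qed.

Let B_cvg0 : B x @[x --> 0^'+] --> 0.
Proof.
have := cvgM (powR_cvg0 p0) s_cvg0.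
by rewrite mul0r; apply.
Qed.

(** The left side is A', where the two terms c cancel. Since B' = x^(p-1) s (p + t), the quotient A'
    / B' is (s / (x c))^(p-2) / (p + t), and s / (x c) = 1 / t. *)
Let AB'E (x : R) : 0 < x < L ->
  x * (s x `^ (p - 1) * c x `^ (2 - p)) = (den (t x))^-1 * B' x.
Proof.
move=> /[dup] xL /andP[x_gt0 _]; rewrite /B' /den /t.
have sx := s0 xL; have cx := c0 xL.
(* All powers are reduced to the exponent [p - 2], so that [field] can treat [a], [b] and [d] as
   atoms. *)
have -> : p - 1 = (p - 2) + 1 by ring.
have -> : 2 - p = - (p - 2) by ring.
have -> : x `^ p = x `^ (p - 2) * x ^+ 2.
  rewrite -(powR_mulrn 2) ?(ltW x_gt0)// -powRD ?(gt_eqF x_gt0) ?implybT//.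
  by rewrite subrK.
rewrite !(@powRD _ _ (p - 2) 1) ?(gt_eqF x_gt0) ?(gt_eqF sx) ?implybT//.
rewrite !powRr1 ?(ltW x_gt0) ?(ltW sx)// powRN.
rewrite !powRM ?invr_ge0 ?mulr_ge0 ?(ltW x_gt0) ?(ltW sx) ?(ltW cx)//.
rewrite -(powR_inv1 (ltW sx)) -powRrM mulN1r powRN (powR_inv1 (ltW sx)).
have a0 := powR_gt0 (p - 2) x_gt0.
have b0 := powR_gt0 (p - 2) sx.
have d0 := powR_gt0 (p - 2) cx.
move: a0 b0 d0.
set a := x `^ _; set b := s x `^ _; set d := c x `^ _ => a0 b0 d0.
have e0 : 0 < p * s x + x * c x by rewrite addr_gt0 ?mulr_gt0.
have p_gt0 := p0.
field.
by rewrite !gt_eqF//= addr_gt0 ?mulr_gt0 ?exprn_gt0.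
Qed.

Let r3_incr (x y : R) : 0 < x -> x < y -> y < L ->
  (den (t x))^-1 < (den (t y))^-1.
Proof.
move=> x_gt0 xy yL.
have xL : 0 < x < L by lra. have yL' : 0 < y < L by lra.
rewrite ltf_pV2.
- by apply: den_incr; [exact: t0|exact: t_decr].
- by rewrite posrE; exact/den_gt0/t0.
- by rewrite posrE; exact/den_gt0/t0.
Qed.

Let Ad (x : R) : 0 < x < L -> is_derive x 1 A ((den (t x))^-1 * B' x).
Proof.
move=> xL.
have cd : is_derive x 1 c (-1 * s x `^ (p - 1) * c x `^ (2 - p)).
  by apply: is_derive_gcos => //; [exact: s0|exact: u0|exact: sd].
have := is_derive_sub (sd xL) (is_derive_mul (is_derive_id x 1) cd).
by move/is_derive_eq; apply; rewrite -AB'E// /c; ring.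
Qed.

Let AB_incr (x y : R) : 0 < x -> x < y -> y < L -> A x / B x < A y / B y.
Proof. exact: (lhopital_incr Ad Bd B'_gt0 A_cvg0 B_cvg0 r3_incr). Qed.

(** Replacing [t x] by its lower bound cos_p^p leaves a bound whose limit at 0 can be read off from
    that of [s]. *)
Let AB_lt (x : R) : 0 < x < L -> A x / B x < (den (1 + -1 * s x `^ p))^-1.
Proof.
move=> xL; apply: lt_trans
  (lhopital_incr_lt Ad Bd B'_gt0 A_cvg0 B_cvg0 r3_incr xL) _.
rewrite ltf_pV2.
- by apply: den_incr; [exact: u0|have /andP[] := t01 xL].
- by rewrite posrE; exact/den_gt0/t0.
- by rewrite posrE; exact/den_gt0/u0.
Qed.

(** The constant is [(den 1)^-1], and [t x < 1]. *)
Let AB_gt (x : R) : 0 < x < L -> (1 + p)^-1 < A x / B x.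
Proof.
apply: (lhopital_gt Ad Bd B'_gt0 A_cvg0 B_cvg0) => y yL.
rewrite -den1 ltf_pV2.
- by apply: den_incr; [exact: t0|have /andP[] := t01 yL].
- by rewrite posrE; exact: den_gt0.
- by rewrite posrE; exact/den_gt0/t0.
Qed.

Let q x := x / (S x / C x).

Let q_gt0 (x : R) : 0 < x < L -> 0 < q x.
Proof. by move=> xL; apply: lt_trans (xtanh_gt xL). Qed.

Let p1 : 0 < p - 1.
Proof. by rewrite subr_gt0; apply: lt_le_trans p2; rewrite ltr1n. Qed.

Let F (x : R) := ln (x / s x).
Let G (x : R) := ln (C x).
Let G' (x : R) := S x `^ (p - 1) * C x `^ (1 - p).

Let xs_gt0 (x : R) : 0 < x < L -> 0 < x / s x.
Proof. by move=> /[dup] xL /andP[x_gt0 _]; rewrite divr_gt0 ?s0. Qed.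

Let Gd (x : R) : 0 < x < L -> is_derive x 1 G (G' x).
Proof.
move=> xL.
have := is_derive_gcos p0 (S0 xL) (U0 xL) (Sd xL).
move/(@is_derive_ln _ C _ _ (C0 xL))/is_derive_eq; apply.
rewrite /G' mul1r -mulrA -(powR_inv1 (ltW (C0 xL))).
rewrite -powRD ?(gt_eqF (C0 xL)) ?implybT//.
by congr (_ * _ `^ _); ring.
Qed.

Let G'_gt0 (x : R) : 0 < x < L -> 0 < G' x.
Proof. by move=> xL; rewrite mulr_gt0// powR_gt0 ?S0 ?C0. Qed.

(** The left side is F' = 1/x - c/s. As [B x] contains x^p, it equals A / B times x^(p-1), and
    x^(p-1) = q^(p-1) tanh_p^(p-1), where the last power is [G' x]. *)
Let FG'E (x : R) : 0 < x < L ->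
  A x / (x * s x) = A x / B x * q x `^ (p - 1) * G' x.
Proof.
move=> /[dup] xL /andP[x_gt0 _]; rewrite /G' /B /q.
have Sx := S0 xL; have Cx := C0 xL; have sx := s0 xL.
rewrite -(mulr_powRB1 (ltW x_gt0) p0).
have -> : 1 - p = - (p - 1) by ring.
rewrite powRN invf_div mulrA.
rewrite !powRM ?invr_ge0 ?mulr_ge0 ?(ltW x_gt0) ?(ltW Sx) ?(ltW Cx)//;
  last by rewrite invr_ge0 ltW.
rewrite -(powR_inv1 (ltW Sx)) -powRrM mulN1r powRN.
have a0 := powR_gt0 (p - 1) x_gt0.
have b0 := powR_gt0 (p - 1) Sx.
have d0 := powR_gt0 (p - 1) Cx.
move: a0 b0 d0.
set a := x `^ _; set b := S x `^ _; set d := C x `^ _ => a0 b0 d0.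
field.
by rewrite !gt_eqF.
Qed.

Let Fd (x : R) : 0 < x < L ->
  is_derive x 1 F (A x / B x * q x `^ (p - 1) * G' x).
Proof.
move=> /[dup] xL /andP[x_gt0 _].
have := @is_derive_div _ _ _ _ _ _ (lt0r_neq0 (s0 xL)) (is_derive_id x 1) (sd
  xL).
move/(@is_derive_ln _ (fun y => y / s y) _ _ (xs_gt0 xL))/is_derive_eq; apply.
rewrite -FG'E// /A /c; field.
by rewrite (gt_eqF x_gt0) (gt_eqF (s0 xL)).
Qed.

Let q_incr (x y : R) : 0 < x -> x < y -> y < L ->
  q x `^ (p - 1) < q y `^ (p - 1).
Proof.
move=> x_gt0 xy yL; have xL : 0 < x < L by lra. have yL' : 0 < y < L by lra.
apply: gt0_ltr_powR; rewrite ?nnegrE ?ltW ?q_gt0 ?xtanh_incr//.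
Qed.

Let AB_gt0 (x : R) : 0 < x < L -> 0 < A x / B x.
Proof.
by move=> xL; apply: lt_trans (AB_gt xL); rewrite invr_gt0 addr_gt0.
Qed.

Let r4_incr (x y : R) : 0 < x -> x < y -> y < L ->
  A x / B x * q x `^ (p - 1) < A y / B y * q y `^ (p - 1).
Proof.
move=> x_gt0 xy yL.
have xL : 0 < x < L by lra. have yL' : 0 < y < L by lra.
rewrite ltr_pM ?powR_ge0 ?(ltW (AB_gt0 xL)) ?AB_incr ?q_incr//.
Qed.

Let G_cvg0 : G x @[x --> 0^'+] --> 0.
Proof.
have /(cvg_comp _ _ C_cvg) : {for 1,
  continuous (@ln R)} by exact: continuous_ln.
by rewrite ln1.
Qed.

(** From x c < s <= x follows 0 <= ln (x / s) <= - ln c, and c tends to 1. The bound s <= x holds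
    because x - s vanishes at 0 and has derivative 1 - c > 0. *)
Let F_cvg0 : F x @[x --> 0^'+] --> 0.
Proof.
have /(cvg_comp _ _ c_cvg) : {for 1,
  continuous (@ln R)} by exact: continuous_ln.
rewrite ln1 => /cvgN; rewrite oppr0 => ln_cvg.
apply: (squeeze_cvgr _ (cvg_cst 0) ln_cvg).
apply: filterS near0L => x /[dup] xL /andP[x_gt0 _].
have sx := s0 xL; have cx := c0 xL.
have := tanx_gt xL; have /andP[_] := t01 xL;
  rewrite /t ltr_pdivrMr// mul1r => H _.
have sltx : s x <= x.
  rewrite -subr_ge0 ltW//.
  apply: (@is_derive_gt0 _ (fun y => y - s y) (fun y => 1 - c y) L
    _ _ x xL).
  - by move=> y yL; exact: is_derive_sub (is_derive_id y 1) (sd yL).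
  - by have := cvgB id_cvg0 s_cvg0; rewrite subr0; apply.
  - by move=> z z0 zx; rewrite subr_gt0 c1//; lra.
apply/andP; split; first by rewrite ln_ge0// ler_pdivlMr ?mul1r.
rewrite -[leRHS]/(- ln (c x)) -lnV ?posrE// ler_ln ?posrE ?invr_gt0 ?xs_gt0//.
by rewrite ler_pdivrMr// ler_pdivlMl// mulrC ltW.
Qed.

Lemma ln_quotient_incr (x y : R) : 0 < x -> x < y -> y < L ->
  ln (x / s x) / ln (gcos p 1 (S x)) < ln (y / s y) / ln (gcos p 1 (S y)).
Proof. exact: (lhopital_incr Fd Gd G'_gt0 F_cvg0 G_cvg0 r4_incr). Qed.

Lemma ln_quotient_gt (x : R) : 0 < x < L ->
  (1 + p)^-1 < ln (x / s x) / ln (gcos p 1 (S x)).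
Proof.
apply: (lhopital_gt Fd Gd G'_gt0 F_cvg0 G_cvg0) => y yL.
(* The bound is compared factor by factor: [A / B] exceeds [(1 + p)^-1], and the power of [q]
   exceeds 1. *)
rewrite -[X in X < _]mulr1 ltr_pM ?invr_ge0 ?AB_gt//.
  by rewrite addr_ge0// ltW.
have := @gt0_ltr_powR _ _ p1 1 (q y); rewrite powR1; apply.
- by rewrite nnegrE.
- by rewrite nnegrE ltW ?q_gt0.
- exact: xtanh_gt.
Qed.

Lemma ln_quotient_cvg :
  ln (x / s x) / ln (gcos p 1 (S x)) @[x --> 0^'+] --> (1 + p)^-1.
Proof.
(* The product of the upper bounds [AB_lt] and [xtanh_lt], the latter raised to the power
   [p - 1]. *)
pose b x := (den (1 + -1 * s x `^ p))^-1 * (1 + 1 * S x `^ p) `^ (p - 1).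
have u_cvg : 1 + -1 * s x `^ p @[x --> 0^'+] --> (1 : R).
  have := cvgD (cvg_cst (1 : R)) (cvgM (cvg_cst (-1 : R))
    (cvg_powR0 p0 near_s0 s_cvg0)).
  by rewrite mulr0 addr0; apply.
have U_cvg : 1 + 1 * S x `^ p @[x --> 0^'+] --> (1 : R).
  have := cvgD (cvg_cst (1 : R)) (cvgM (cvg_cst (1 : R))
    (cvg_powR0 p0 near_S0 S_cvg0)).
  by rewrite mulr0 addr0; apply.
have den_cvg : den (1 + -1 * s x `^ p) @[x --> 0^'+] --> 1 + p.
  rewrite -den1 /den; apply: cvgM; first exact: cvg_powR.
  by apply: cvgD => //; exact: cvg_cst.
have b_cvg : b x @[x --> 0^'+] --> (1 + p)^-1.
  have p1_neq0 : 1 + p != 0 by rewrite gt_eqF// addr_gt0.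
  have := cvgM (cvgV p1_neq0 den_cvg) (cvg_powR (r := p - 1) ltr01 U_cvg).
  by rewrite powR1 mulr1; apply.
apply: (squeeze_cvgr _ (cvg_cst (1 + p)^-1) b_cvg).
apply: filterS near0L => x xL; rewrite (ltW (ln_quotient_gt xL))/=.
apply/ltW/(lt_trans (lhopital_incr_lt Fd Gd G'_gt0 F_cvg0 G_cvg0 r4_incr xL)).
rewrite ltr_pM ?powR_ge0 ?(ltW (AB_gt0 xL)) ?AB_lt//.
apply: gt0_ltr_powR => //; rewrite ?nnegrE ?ltW ?q_gt0 ?U0//.
exact: xtanh_lt.
Qed.

End sine_sinh_ratio.

(** * Integrability up to a singular endpoint, and the derivative of an integral in its upper
    limit *)

Section singular_integrals.
Context {R : realType}.
Notation mu := (@lebesgue_measure R).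

(** The endpoint [b] is negligible. On closed intervals ending short of [b] the integral of [h] is
    an increment of [H], at most [M - H a], and monotone convergence carries this bound to [[a,
    b[]. *)
Lemma integrable_bounded_primitive (H h : R -> R) (a b M : R) :
  measurable_fun setT h ->
  (forall x, a <= x < b -> 0 <= h x) ->
  (forall x, a <= x < b -> {for x, continuous h}) ->
  (forall x : R, a <= x < b -> is_derive x 1 H (h x)) ->
  (forall x, a <= x < b -> H x <= M) ->
  mu.-integrable `[a, b] (EFin \o h).
Proof.
move=> mh h0 hc Hd HM.
have mhD (D : set R) : measurable_fun D (fun x : R => (h x)%:E).
  by apply/measurable_EFinP; exact: measurable_funS mh.
apply/integrableP; split; first exact: mhD.
rewrite -integral_itv_bndo_bndc; last first.
  by apply: measurableT_comp => //; exact: mhD.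
under eq_integral => x.
  rewrite inE /= in_itv/= => /h0 hx; rewrite ger0_norm//; over.
have [ba|ab] := leP b a.
  by rewrite set_itv_ge ?integral_set0// bnd_simp -leNgt.
apply: (@le_lt_trans _ _ (M - H a)%:E); last exact: ltry.
rewrite itv_bnd_open_bigcup.
apply: (@cvge_to_le _ _ _ _ _ _ _ (ge0_nondecreasing_set_cvg_integral _ _ _ _)).
- move=> n m nm; rewrite subsetEset; apply: subset_itvl; rewrite bnd_simp.
  by rewrite lerB// lef_pV2 ?posrE// ler_nat.
- by move=> n; exact: measurable_itv.
- by move=> n; exact: mhD.
- move=> n x /=; rewrite in_itv/= lee_fin => /andP[ax xb]; apply: h0.
  rewrite ax (le_lt_trans xb)// ltrBlDr ltrDl//.
apply: nearW => n; set d := b - _.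
have db : d < b by rewrite ltrBlDr ltrDl.
(* For small [n] the truncated interval contains at most the point [a], and the integral is 0. *)
have [da|ad] := leP d a.
  rewrite (@integral_Sset1 _ _ _ a) ?lee_fin ?subr_ge0 ?HM ?lexx//.
  by move=> x /=; rewrite in_itv/= => /andP[ax xd]; lra.
have Hd' x : a <= x <= d -> is_derive x 1 H (h x).
  by move=> /andP[ax xd]; apply: Hd; rewrite ax (le_lt_trans xd).
rewrite (continuous_FTC2 ad (F := H)).
- by rewrite -EFinB lee_fin lerB// HM// (ltW ad).
- apply: continuous_in_subspaceT => x /[!inE]/=/[!in_itv]/= /andP[ax xd].
  by apply: hc; rewrite ax (le_lt_trans xd).
- split.
  + move=> x /[!in_itv]/= /andP[ax xd].
    by have [] := Hd' x; rewrite ?(ltW ax) ?(ltW xd).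
  + by apply: cvg_at_right_filter; apply: is_derive_cvg (Hd' _ _); lra.
  + by apply: cvg_at_left_filter; apply: is_derive_cvg (Hd' _ _); lra.
- move=> x /[!in_itv]/= /andP[ax xd]; rewrite derive1E.
  by have [] := Hd' x; rewrite ?(ltW ax) ?(ltW xd).
Qed.

Lemma integrable_bounded_itv (h : R -> R) (a b M : R) :
  measurable_fun setT h -> (forall x, a <= x <= b -> `|h x| <= M) ->
  mu.-integrable `[a, b] (EFin \o h).
Proof.
move=> mh hM.
apply: measurable_bounded_integrable.
- exact: measurable_itv.
- exact/compact_finite_measure/segment_compact.
- exact: measurable_funS mh.
- exists M; split; first exact: num_real.
  by move=> y My x /=; rewrite in_itv/= => /hM /le_trans; apply; exact: ltW.
Qed.

Lemma is_derive_Rintegral (f : R -> R) (a u x : R) :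
  mu.-integrable `[a, u] (EFin \o f) -> a < x -> x < u ->
  {for x, continuous f} ->
  is_derive x 1 (fun y => \int[mu]_(t in `[a, y]) f t) (f x).
Proof.
move=> fi ax xu fc; have [Fd Fx] := continuous_FTC1_closed xu fi ax fc.
by split; [exact: Fd|rewrite -derive1E Fx].
Qed.

End singular_integrals.

(** * Derivatives and endpoint limits of inverse functions *)

Section inverse_functions.
Context {R : realType}.
Implicit Types (A : set R) (F f s : R -> R).

Lemma is_derive_pinv A F f (x : R) : {in A &, {homo F : x y / x < y}} ->
  (\forall z \near x, A z) ->
    (\forall z \near x, is_derive (z : R) 1 F (f z)) ->
  f x != 0 -> is_derive (F x) 1 ('pinv_(fun=> 0) A F) (f x)^-1.
Proof.
move=> Flt Ax Fd fx0.
have Finj : {in A &, injective F}.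
  move=> y z yA zA Fyz; case: (ltgtP y z) => // yz.
    by have := Flt _ _ yA zA yz; rewrite Fyz ltxx.
  by have := Flt _ _ zA yA yz; rewrite Fyz ltxx.
apply: is_derive_inverse => //.
- by apply: filterS Ax => z Az; rewrite pinvKV// inE.
- by apply: filterS Fd => z; exact: is_derive_cvg.
- exact: nbhs_singleton Fd.
Qed.

(** For the inverse [s] of [F], the value [F e] itself serves as the radius: below it, [s] stays
    under [e]. Halving [Num.min e b] keeps the tolerance inside []0, b[]. *)
Lemma inverse_cvg0 F s b : 0 < b -> (forall e : R, 0 < e < b -> 0 < F e) ->
  (forall e y : R, 0 < e < b -> 0 < y -> y < F e -> 0 < s y < e) ->
  s y @[y --> 0^'+] --> 0.
Proof.
move=> b0 F0 sF; apply/cvgrPdist_lt => /= e e0; pose d := Num.min e b / 2.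
have db : 0 < d < b by rewrite /d; case: (ltP e b) => ?; lra.
have de : d < e by rewrite /d; case: (ltP e b) => ?; lra.
near=> y; have /andP[sy0 syd] : 0 < s y < d.
  by apply: sF => //; near: y; apply: nbhs_right_lt; exact: F0.
by rewrite sub0r normrN gtr0_norm// (lt_trans syd).
Unshelve. all: by end_near. Qed.

Lemma inverse_cvg1 F s L : (forall e : R, 0 < e < 1 -> F e < L) ->
  (forall e y : R, 0 < e < 1 -> F e < y -> y < L -> e < s y < 1) ->
  s y @[y --> L^'-] --> (1 : R).
Proof.
move=> FL sF; apply/cvgrPdist_lt => /= e e0; pose d := Num.min e 1 / 2.
have db : 0 < 1 - d < 1 by rewrite /d; case: (ltP e 1) => ?; lra.
have de : d < e by rewrite /d; case: (ltP e 1) => ?; lra.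
near=> y; have /andP[sy0 syd] : 1 - d < s y < 1.
  by apply: sF => //; near: y; apply: nbhs_left_gt; exact: FL.
rewrite gtr0_norm ?subr_gt0//; lra.
Unshelve. all: by end_near. Qed.

End inverse_functions.

(** * The integrals [arcsin_p] and [arsinh_p]: derivatives, monotonicity, ranges *)

Section arcsin_arsinh.
Context {R : realType}.
Variable p : R.
Hypothesis p2 : 2 <= p.
Notation mu := (@lebesgue_measure R).

Let p0 : 0 < p. Proof. by apply: lt_le_trans p2. Qed.

Let h sg (t : R) := (1 + sg * t `^ p) `^ (- p^-1).

Let gcosV sg (x : R) : (gcos p sg x)^-1 = h sg x.
Proof. by rewrite /h powRN. Qed.

Let measurable_h sg : measurable_fun setT (h sg).
Proof.
have := @measurableT_comp _ _ _ _ _ _ (fun y : R => y `^ (- p^-1)) _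
  (fun t : R => 1 + sg * t `^ p); apply; first exact: measurable_powR.
apply: measurable_funD; first exact: measurable_cst.
apply: measurable_funM; first exact: measurable_cst.
exact: measurable_powR.
Qed.

Let continuous_h sg (x : R) : 0 < x -> 0 < 1 + sg * x `^ p ->
  {for x, continuous (h sg)}.
Proof.
move=> x0 u0.
have ud := is_derive_shift 1 (is_derive_scale sg (is_derive1_powR p x0)).
exact: is_derive_cvg (@is_derive_powR _ (- p^-1) (fun t => 1 + sg * t `^ p) _ _
  u0 ud).
Qed.

Let powR_lt1 (x : R) : 0 <= x < 1 -> 0 <= x `^ p < 1.
Proof.
move=> /andP[x0 x1]; rewrite powR_ge0/=.
have := @gt0_ltr_powR _ p p0 x 1; rewrite powR1; apply => //.
by rewrite nnegrE.
Qed.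

Let powR_le_id (x : R) : 0 <= x <= 1 -> x `^ p <= x.
Proof.
move=> /andP[]; rewrite le_eqVlt => /predU1P[<- _|x0 x1].
  by rewrite powR0 ?gt_eqF.
by apply: ge1r_powR; [rewrite x0|have := p2; lra].
Qed.

Let arcsinE (x : R) :
  arcsin_p p x = \int[mu]_(t in `[0, x]) h (-1) t.
Proof. by apply: eq_Rintegral => t _; rewrite /h mulN1r. Qed.

Let arsinhE (x : R) :
  arsinh_p p x = \int[mu]_(t in `[0, x]) h 1 t.
Proof. by apply: eq_Rintegral => t _; rewrite /h mul1r. Qed.

(* [1 - t `^ p >= 1 - t] on [0, 1] and [p >= 2], so [(1 - t) `^ (- 2^-1)]
   dominates the integrand; its primitive is [- 2 * (1 - t) `^ 2^-1]. *)
Let arcsin_integrable : mu.-integrable `[0, 1] (EFin \o h (-1)).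
Proof.
pose k (t : R) := (1 - t) `^ (- 2^-1).
have k1d (x : R) : is_derive x 1 (fun t => 1 - t) (-1).
  by rewrite -[X in is_derive _ _ _ X]add0r; exact: is_derive_sub.
have ki : mu.-integrable `[0, 1] (EFin \o k).
  apply: (@integrable_bounded_primitive _ (fun t => - 2 * (1 - t) `^ 2^-1)
    k 0 1 0).
  - have := @measurableT_comp _ _ _ _ _ _ (fun y : R => y `^ (- 2^-1)) _
      (fun t : R => 1 - t); apply; first exact: measurable_powR.
    by apply: measurable_funB; [exact: measurable_cst|exact: measurable_id].
  - by move=> x _; exact: powR_ge0.
  - move=> x /andP[x0 x1]; have u0 : 0 < 1 - x by lra.
    exact: is_derive_cvg (@is_derive_powR _ _ (fun t => 1 - t) _ _ u0 (k1d x)).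
  - move=> x /andP[x0 x1]; have u0 : 0 < 1 - x by lra.
    have := @is_derive_powR _ 2^-1 (fun t => 1 - t) _ _ u0 (k1d x).
    move/(is_derive_scale (- 2))/is_derive_eq; apply; rewrite /k.
    rewrite (_ : 2^-1 - 1 = - 2^-1); last by field.
    by field.
  - by move=> x _; rewrite mulNr oppr_le0 mulr_ge0// powR_ge0.
apply: le_integrable ki.
- exact: measurable_itv.
- by apply/measurable_EFinP; apply: measurable_funS (measurable_h _).
move=> x /=; rewrite in_itv/= => /andP[x0 x1].
rewrite lee_fin !ger0_norm ?powR_ge0// /h /k.
(* At [x = 1] the base of the integrand is 0 and the power takes the default value 0, so domination
   is trivial there. *)
move: x1; rewrite le_eqVlt => /predU1P[->|x1].
  rewrite powR1 mulN1r subrr powR0 ?powR_ge0//.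
  by rewrite oppr_eq0 invr_eq0 gt_eqF.
have xp : x `^ p <= x by rewrite powR_le_id// x0 ltW.
have xp0 := powR_ge0 x p.
have pV : p^-1 <= 2^-1 by rewrite lef_pV2 ?posrE.
apply: (@le_trans _ _ ((1 - x) `^ (- p^-1))); last first.
  by apply: ger_powR; lra.
rewrite !powRN lef_pV2 ?posrE ?powR_gt0//; [|lra..].
by apply: ge0_ler_powR; rewrite ?invr_ge0 ?(ltW p0) ?nnegrE//; lra.
Qed.

Let arsinh_integrable (u : R) : mu.-integrable `[0, u] (EFin \o h 1).
Proof.
apply: (@integrable_bounded_itv _ _ _ _ 1); first exact: measurable_h.
move=> x /andP[x0 _]; have xp0 := powR_ge0 x p.
rewrite ger0_norm ?powR_ge0// /h powRN invf_le1 ?powR_gt0//; last lra.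
have := @ge0_ler_powR _ p^-1; rewrite invr_ge0 (ltW p0) => /(_ isT 1).
rewrite powR1; apply; rewrite ?nnegrE//; lra.
Qed.

Lemma arcsin_p0 : arcsin_p p 0 = 0.
Proof. by rewrite /arcsin_p set_itv1 Rintegral_set1. Qed.

Lemma arsinh_p0 : arsinh_p p 0 = 0.
Proof. by rewrite /arsinh_p set_itv1 Rintegral_set1. Qed.

Lemma is_derive_arcsin_p (x : R) : 0 < x < 1 ->
  is_derive x 1 (arcsin_p p) (gcos p (-1) x)^-1.
Proof.
move=> /andP[x0 x1].
rewrite gcosV (_ : arcsin_p p = fun y => \int[mu]_(t in `[0, y]) h (-1) t);
  last exact/funext/arcsinE.
apply: (is_derive_Rintegral arcsin_integrable) => //.
apply: continuous_h => //; have : 0 <= x `^ p < 1 by rewrite powR_lt1// ltW.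
lra.
Qed.

Lemma is_derive_arsinh_p (x : R) : 0 < x ->
  is_derive x 1 (arsinh_p p) (gcos p 1 x)^-1.
Proof.
move=> x0.
rewrite gcosV (_ : arsinh_p p = fun y => \int[mu]_(t in `[0, y]) h 1 t);
  last exact/funext/arsinhE.
apply: (is_derive_Rintegral (arsinh_integrable (x + 1))) => //; first lra.
by apply: continuous_h => //; have := powR_ge0 x p; lra.
Qed.

Lemma continuous_arcsin_p : {within `[0, 1], continuous (arcsin_p p)}.
Proof.
rewrite (_ : arcsin_p p = fun y => \int[mu]_(t in `[0, y]) h (-1) t);
  last exact/funext/arcsinE.
exact: parameterized_integral_continuous arcsin_integrable.
Qed.

Lemma continuous_arsinh_p (u : R) : 0 <= u ->
  {within `[0, u], continuous (arsinh_p p)}.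
Proof.
move=> u0.
rewrite (_ : arsinh_p p = fun y => \int[mu]_(t in `[0, y]) h 1 t);
  last exact/funext/arsinhE.
exact: parameterized_integral_continuous (arsinh_integrable u).
Qed.

Lemma arcsin_p_lt : {in `[0, 1] &, {homo arcsin_p p : x y / x < y}}.
Proof.
apply: gtr0_derive1_lt_cc continuous_arcsin_p => x; rewrite in_itv/= => x01.
  by have [] := is_derive_arcsin_p x01.
rewrite derive1E; have [_ ->] := is_derive_arcsin_p x01.
rewrite invr_gt0 gcos_gt0//; have : 0 <= x `^ p < 1 by apply: powR_lt1; lra.
lra.
Qed.

Lemma arsinh_p_lt (x y : R) : 0 <= x -> x < y -> arsinh_p p x < arsinh_p p y.
Proof.
move=> x0 xy; have y0 : 0 < y by lra.
apply: (gtr0_derive1_lt_cc _ _ (continuous_arsinh_p (ltW y0))) => //.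
- by move=> z; rewrite in_itv/= => /andP[/is_derive_arsinh_p[]].
- move=> z; rewrite in_itv/= derive1E => /andP[/is_derive_arsinh_p[_ ->] _].
  by rewrite invr_gt0 gcos_gt0//; have := powR_ge0 z p; lra.
- by rewrite in_itv/= x0 ltW.
- by rewrite in_itv/= ltW/=.
Qed.

Lemma arcsin_p_surj (y : R) : 0 < y < arcsin_p p 1 ->
  exists2 x, 0 < x < 1 & arcsin_p p x = y.
Proof.
move=> /andP[y0 y1].
have L0 : arcsin_p p 0 <= arcsin_p p 1 by rewrite arcsin_p0; lra.
have [|x] := segment_continuous_le_surjective ler01 L0 continuous_arcsin_p (t
  := y).
  by rewrite /= in_itv/= arcsin_p0 !ltW.
rewrite /= in_itv/= => /andP[x0 x1] xy; exists x => //.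
rewrite !lt_neqAle x0 x1 !andbT; apply/andP; split; apply/eqP => xE; move: xy.
  by rewrite -xE arcsin_p0; lra.
by rewrite xE; lra.
Qed.

(** Serves to show that [arsinh_p] is unbounded. Its integrand exceeds 1 / (1 + t) because 1 + t^p <
    (1 + t)^p. *)
Let ln_lt_arsinh_p (x : R) : 0 < x -> ln (1 + x) < arsinh_p p x.
Proof.
move=> x0; rewrite -subr_gt0.
apply: (@is_derive_gt0 _ (fun y => arsinh_p p y - ln (1 + y))
  (fun y => (gcos p 1 y)^-1 - 1 / (1 + y)) (x + 1)).
- move=> y /andP[y0 _]; have y1 : 0 < 1 + y by lra.
  apply: is_derive_sub; first exact: is_derive_arsinh_p.
  exact: (@is_derive_ln _ (fun y => 1 + y) _ _ y1
    (is_derive_shift 1 (is_derive_id y 1))).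
- have [_ + _] := (continuous_within_itvP (arsinh_p p) ltr01).1
    (continuous_arsinh_p ler01).
  have y1_cvg : 1 + y @[y --> (0 : R)^'+] --> (1 + 0 : R).
    by apply: cvgD; [exact: cvg_cst|exact: cvg_at_right_filter].
  have ln_cont : {for 1 + 0, continuous (@ln R)}.
    by rewrite addr0; exact: continuous_ln.
  move=> a_cvg; have := cvgB a_cvg (cvg_comp _ _ y1_cvg ln_cont).
  by rewrite arsinh_p0 addr0 ln1 subrr; apply.
- lra.
move=> y y0 _; rewrite subr_gt0 div1r.
have yp0 := powR_ge0 y p.
rewrite ltf_pV2 ?posrE ?gcos_gt0//; [|lra..].
have -> : 1 + y = ((1 + y) `^ p) `^ p^-1.
  by rewrite -powRrM divff ?lt0r_neq0// powRr1//; lra.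
apply: gt0_ltr_powR; rewrite ?invr_gt0 ?nnegrE ?powR_ge0//; first lra.
(* One factor is split off each power: (1 + y)^p = (1 + y)^(p-1) + y (1 + y)^(p-1), and the summands
   dominate 1 and y y^(p-1). *)
rewrite mul1r -(mulr_powRB1 (ltW y0) p0) -(@mulr_powRB1 _ (1 + y) p)//;
  last lra.
have p1 : 0 < p - 1 by have := p2; lra.
have h1 : 1 < (1 + y) `^ (p - 1).
  have := @gt0_ltr_powR _ _ p1 1 (1 + y); rewrite powR1; apply;
  by rewrite ?nnegrE//; lra.
have h2 : y `^ (p - 1) <= (1 + y) `^ (p - 1).
  by apply: ge0_ler_powR; rewrite ?nnegrE; lra.
have : y * y `^ (p - 1) <= y * (1 + y) `^ (p - 1) by rewrite ler_wpM2l// ltW.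
lra.
Qed.

Lemma arsinh_p_surj (y : R) : 0 < y -> exists2 x, 0 < x & arsinh_p p x = y.
Proof.
move=> y0; have e0 := expR_gt0 y.
(* [expR y] is a right end for the intermediate value theorem, since ln (1 + e^y) > y. *)
have ye : y <= arsinh_p p (expR y).
  apply/ltW/(le_lt_trans _ (ln_lt_arsinh_p e0)).
  by rewrite -{1}(expRK y) ler_ln ?posrE//; lra.
have L0 : arsinh_p p 0 <= arsinh_p p (expR y) by rewrite arsinh_p0; lra.
have [|x] := segment_continuous_le_surjective (ltW e0) L0
  (continuous_arsinh_p (ltW e0)) (t := y).
  by rewrite /= in_itv/= arsinh_p0 ltW.
rewrite /= in_itv/= => /andP[x0 x1] xy; exists x => //.
rewrite lt_neqAle x0 andbT; apply/eqP => xE; move: xy.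
by rewrite -xE arsinh_p0; lra.
Qed.

End arcsin_arsinh.

(** * The functions [sin_p], [sinh_p] and [cosh_p]: differential equations and limits *)

Section sin_sinh.
Context {R : realType}.
Variable p : R.
Hypothesis p2 : 2 <= p.

Let p0 : 0 < p. Proof. by apply: lt_le_trans p2. Qed.

Lemma arcsin_p_gt0 (x : R) : 0 < x <= 1 -> 0 < arcsin_p p x.
Proof.
move=> /andP[x0 x1]; rewrite -(arcsin_p0 p); apply: arcsin_p_lt => //.
  by rewrite in_itv/= lexx ler01.
by rewrite in_itv/= (ltW x0).
Qed.

Lemma sin_p_arcsin_p (x : R) : 0 < x < 1 -> sin_p p (arcsin_p p x) = x.
Proof.
move=> /andP[x0 x1]; apply: pinvKV; last by rewrite inE/= in_itv/= !ltW.
move=> y z; rewrite !inE/= => y01 z01 yz; case: (ltgtP y z) => // H.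
  by have := arcsin_p_lt p2 y01 z01 H; rewrite yz ltxx.
by have := arcsin_p_lt p2 z01 y01 H; rewrite yz ltxx.
Qed.

Lemma sinh_p_arsinh_p (x : R) : 0 < x -> sinh_p p (arsinh_p p x) = x.
Proof.
move=> x0; apply: pinvKV; last by rewrite inE/= in_itv/= x0.
move=> y z; rewrite !inE/= !in_itv/= !andbT => y0 z0 yz.
case: (ltgtP y z) => // H.
  by have := arsinh_p_lt p2 (ltW y0) H; rewrite yz ltxx.
by have := arsinh_p_lt p2 (ltW z0) H; rewrite yz ltxx.
Qed.

Lemma sin_p_lt (e y : R) : 0 < e < 1 -> 0 < y < arcsin_p p 1 ->
  (sin_p p y < e) = (y < arcsin_p p e).
Proof.
move=> e01 /(arcsin_p_surj p2)[x x01 <-]; rewrite sin_p_arcsin_p//.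
have xI : x \in `[0, 1] by rewrite in_itv/=; lra.
have eI : e \in `[0, 1] by rewrite in_itv/=; lra.
exact/esym/(leW_mono_in (le_mono_in (arcsin_p_lt p2))).
Qed.

Lemma sin_p01 (y : R) : 0 < y < arcsin_p p 1 -> 0 < sin_p p y < 1.
Proof. by move=> /(arcsin_p_surj p2)[x x01 <-]; rewrite sin_p_arcsin_p. Qed.

Lemma sinh_p_gt0 (y : R) : 0 < y -> 0 < sinh_p p y.
Proof. by move=> /(arsinh_p_surj p2)[x x0 <-]; rewrite sinh_p_arsinh_p. Qed.

(** By the inverse function rule, since [arcsin_p] has derivative 1 / cos_p as a function of the
    sine. *)
Lemma is_derive_sin_p (y : R) : 0 < y < arcsin_p p 1 ->
  is_derive y 1 (sin_p p) (gcos p (-1) (sin_p p y)).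
Proof.
move=> /(arcsin_p_surj p2)[x x01 <-]; rewrite sin_p_arcsin_p//.
have near01 : \forall z \near x, 0 < z < 1.
  by have := @near_in_itvoo _ 0 1 x; rewrite in_itv/= => /(_ x01).
rewrite -[gcos _ _ _]invrK.
apply: (@is_derive_pinv _ _ _ (fun z => (gcos p (-1) z)^-1)).
- by move=> z t /[!inE]; exact: arcsin_p_lt.
- by apply: filterS near01 => z z01; rewrite /= in_itv/=; lra.
- by apply: filterS near01 => z; exact: is_derive_arcsin_p.
- rewrite gt_eqF// invr_gt0 gcos_gt0//.
  have /andP[x0 x1] := x01; have := @gt0_ltr_powR _ p p0 x 1.
  rewrite powR1 !nnegrE ltW// ler01 => /(_ isT isT x1); lra.
Qed.

Lemma is_derive_sinh_p (y : R) : 0 < y ->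
  is_derive y 1 (sinh_p p) (gcos p 1 (sinh_p p y)).
Proof.
move=> /(arsinh_p_surj p2)[x x0 <-]; rewrite sinh_p_arsinh_p//.
have near0 : \forall z \near x, 0 < z by exact: lt_nbhsr.
rewrite -[gcos _ _ _]invrK.
apply: (@is_derive_pinv _ _ _ (fun z => (gcos p 1 z)^-1)).
- move=> z t; rewrite !inE/= !in_itv/= !andbT => z0 _.
  by apply: arsinh_p_lt => //; exact: ltW.
- by apply: filterS near0 => z z0; rewrite /= in_itv/= z0.
- by apply: filterS near0 => z; exact: is_derive_arsinh_p.
- by rewrite gt_eqF// invr_gt0 gcos_gt0//; have := powR_ge0 x p; lra.
Qed.

(** This is cosh_p^p - sinh_p^p = 1 solved for cosh_p, which is defined as a derivative. *)
Lemma cosh_pE (y : R) : 0 < y -> cosh_p p y = gcos p 1 (sinh_p p y).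
Proof. by move=> /is_derive_sinh_p[_ <-]; rewrite /cosh_p derive1E. Qed.

Lemma cosh_p_gt1 (y : R) : 0 < y -> 1 < cosh_p p y.
Proof.
move=> y0; rewrite cosh_pE//; have S0 := powR_gt0 p (sinh_p_gt0 y0).
have := @gt0_ltr_powR _ p^-1; rewrite invr_gt0 p0 => /(_ isT 1).
rewrite powR1; apply; rewrite ?nnegrE//; lra.
Qed.

Lemma sin_p_cvg0 : sin_p p y @[y --> 0^'+] --> 0.
Proof.
apply: (@inverse_cvg0 _ (arcsin_p p) _ 1) => // [e e01|e y e01 y0 ye].
  by apply: arcsin_p_gt0; lra.
have yL : 0 < y < arcsin_p p 1.
  rewrite y0 (lt_trans ye)//; apply: arcsin_p_lt => //;
    try (rewrite in_itv/=); lra.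
by rewrite sin_p_lt// ye; have /andP[->] := sin_p01 yL.
Qed.

(** This is why no sine appears in [beta]. *)
Lemma sin_p_cvg1 : sin_p p y @[y --> (arcsin_p p 1)^'-] --> (1 : R).
Proof.
have aL (e : R) : 0 < e < 1 -> arcsin_p p e < arcsin_p p 1.
  by move=> e01; apply: arcsin_p_lt => //; try (rewrite in_itv/=); lra.
apply: (@inverse_cvg1 _ (arcsin_p p)) => // e y e01 ye yL.
have y0 : 0 < arcsin_p p e by apply: arcsin_p_gt0; lra.
have /(arcsin_p_surj p2)[x x01 xy] : 0 < y < arcsin_p p 1 by lra.
move: ye; rewrite -xy sin_p_arcsin_p// => aex.
have /andP[_ ->] := x01; rewrite andbT.
have := @leW_mono_in _ _ _ _ _ _ (le_mono_in (arcsin_p_lt p2)) e x.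
by rewrite aex => <-//; rewrite in_itv/=; lra.
Qed.

Lemma sinh_p_cvg0 : sinh_p p y @[y --> 0^'+] --> 0.
Proof.
apply: (@inverse_cvg0 _ (arsinh_p p) _ 1) => // [e /andP[e0 _]|e y /andP[e0 _]
  y0].
  by rewrite -(arsinh_p0 p); apply: arsinh_p_lt.
move=> ye; rewrite sinh_p_gt0//=; move: y0 ye => /(arsinh_p_surj p2)[x x0 <-].
rewrite sinh_p_arsinh_p// => xe; rewrite ltNge; apply/negP.
rewrite le_eqVlt => /predU1P[ex|ex]; move: xe; first by rewrite ex ltxx.
by rewrite ltNge ltW// arsinh_p_lt// ltW.
Qed.

End sin_sinh.

(** * Logarithmic form of the two bounds, and the best constants *)

Lemma lt_ln_quotient {R : realType} (x s c a : R) : 0 < x -> 0 < s -> 1 < c ->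
  (s / x < 1 / c `^ a) = (a < ln (x / s) / ln c).
Proof.
move=> x0 s0 c1; have c0 : 0 < c by lra.
rewrite [RHS]ltr_pdivlMr ?ln_gt0// -ln_powR ltr_ln ?posrE ?powR_gt0 ?divr_gt0//.
by rewrite div1r -[s / x]invf_div ltf_pV2 ?posrE ?powR_gt0 ?divr_gt0.
Qed.

Lemma gt_ln_quotient {R : realType} (x s c b : R) : 0 < x -> 0 < s -> 1 < c ->
  (1 / c `^ b < s / x) = (ln (x / s) / ln c < b).
Proof.
move=> x0 s0 c1; have c0 : 0 < c by lra.
rewrite [RHS]ltr_pdivrMr ?ln_gt0// -ln_powR ltr_ln ?posrE ?powR_gt0 ?divr_gt0//.
by rewrite div1r -[s / x]invf_div ltf_pV2 ?posrE ?powR_gt0 ?divr_gt0.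
Qed.

Theorem theorem1p4 (R : realType) (p : R) (hp : 2 <= p) :
  let g := fun x : R => ln (x / sin_p p x) / ln (cosh_p p x) in
  let alpha := 1 / (1 + p) in
  let beta := ln (pi_p p / 2) / ln (cosh_p p (pi_p p / 2)) in
  [/\ (forall x y : R, 0 < x -> x < y -> y < pi_p p / 2 -> g x < g y),
      (forall x : R, 0 < x < pi_p p / 2 ->
         1 / cosh_p p x `^ beta < sin_p p x / x /\
         sin_p p x / x < 1 / cosh_p p x `^ alpha),
      (forall a : R,
         (forall x : R, 0 < x < pi_p p / 2 ->
            sin_p p x / x < 1 / cosh_p p x `^ a) -> a <= alpha) &
      (forall b : R,
         (forall x : R, 0 < x < pi_p p / 2 ->
            1 / cosh_p p x `^ b < sin_p p x / x) -> beta <= b)].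
Proof.
move=> g alpha beta; set L := pi_p p / 2.
have LE : L = arcsin_p p 1 by rewrite /L /pi_p; field.
have L0 : 0 < L by rewrite LE arcsin_p_gt0// ltr01 lexx.
pose S := sinh_p p.
have gE x : 0 < x -> g x = ln (x / sin_p p x) / ln (gcos p 1 (S x)).
  by move=> x0; rewrite /g cosh_pE.
have s01 (x : R) : 0 < x < L -> 0 < sin_p p x < 1 by rewrite LE; exact: sin_p01.
have S0 (x : R) : 0 < x < L -> 0 < S x by move=> /andP[x0 _]; exact: sinh_p_gt0.
have sd (x : R) : 0 < x < L ->
  is_derive x 1 (sin_p p) (gcos p (-1) (sin_p p x)).
  by rewrite LE; exact: is_derive_sin_p.
have Sd (x : R) : 0 < x < L -> is_derive x 1 S (gcos p 1 (S x)).
  by move=> /andP[x0 _]; exact: is_derive_sinh_p.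
have s_cvg0 := sin_p_cvg0 hp; have S_cvg0 := sinh_p_cvg0 hp.
have g_incr (x y : R) : 0 < x -> x < y -> y < L -> g x < g y.
  move=> x0 xy yL; rewrite !gE//; last lra.
  exact: (ln_quotient_incr hp s01 S0 sd Sd s_cvg0 S_cvg0 L0).
have g_gt (x : R) : 0 < x < L -> alpha < g x.
  move=> xL; rewrite gE//; last lra.
  rewrite /alpha div1r;
    exact: (ln_quotient_gt hp s01 S0 sd Sd s_cvg0 S_cvg0 L0).
have g_cvg0 : g x @[x --> 0^'+] --> alpha.
  rewrite /alpha div1r; apply: cvg_trans
    (ln_quotient_cvg hp s01 S0 sd Sd s_cvg0 S_cvg0 L0).
  apply: near_eq_cvg; near=> x; apply/esym/gE.
  by near: x; exact: nbhs_right_gt.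
have lnC_neq0 : ln (cosh_p p L) != 0 by rewrite gt_eqF// ln_gt0// cosh_p_gt1.
(* [sin_p] enters through its left limit 1, while [cosh_p] is continuous at [L], an interior point
   of its domain. *)
have g_cvgL : g x @[x --> L^'-] --> beta.
  have s_cvg1 : sin_p p x @[x --> L^'-] --> (1 : R) by rewrite LE;
    exact: sin_p_cvg1.
  have id_cvg : x @[x --> L^'-] --> L by exact: cvg_at_left_filter.
  have C_cvg : cosh_p p x @[x --> L^'-] --> cosh_p p L.
    rewrite cosh_pE//; apply: (@cvg_trans _ (gcos p 1 (S x) @[x --> L^'-])).
      apply: near_eq_cvg; near=> x; apply/esym/(cosh_pE hp).
      by near: x; exact: nbhs_left_gt.
    have SL : is_derive L 1 S (gcos p 1 (S L)) by exact: is_derive_sinh_p.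
    have SL0 : 0 < S L by exact: sinh_p_gt0.
    have U0 : 0 < 1 + 1 * S L `^ p by have := powR_gt0 p SL0; lra.
    have p0 : 0 < p by lra.
    apply: cvg_at_left_filter.
    exact: is_derive_cvg (is_derive_gcos p0 SL0 U0 SL).
  rewrite /beta -/L; apply: cvgM; last apply: cvgV => //.
    have q_cvg : x / sin_p p x @[x --> L^'-] --> L.
      have := cvgM id_cvg (cvgV (oner_neq0 R) s_cvg1).
      by rewrite invr1 mulr1; apply.
    exact: (cvg_comp _ _ q_cvg (continuous_ln L0)).
  have cL : 0 < cosh_p p L by apply: lt_trans (cosh_p_gt1 hp L0).
  exact: (cvg_comp _ _ C_cvg (continuous_ln cL)).
have g_le (x : R) : 0 < x < L -> g x <= beta.
  move=> /andP[x0 xL]; apply: (cvgr_to_ge g_cvgL); near=> y;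
    apply/ltW/g_incr => //;
  by near: y; [exact: nbhs_left_gt|exact: nbhs_left_lt].
(* The limit gives only a weak inequality; passing through the midpoint of [x] and [L] makes it
   strict. *)
have g_lt (x : R) : 0 < x < L -> g x < beta.
  move=> /andP[x0 xL]; apply: (@lt_le_trans _ _ (g ((x + L) / 2))).
    by apply: g_incr; lra.
  by apply: g_le; lra.
have loE (x b : R) : 0 < x < L ->
    (1 / cosh_p p x `^ b < sin_p p x / x) = (g x < b).
  move=> /[dup] /s01 /andP[sx _] /andP[x0 _].
  by rewrite gt_ln_quotient// cosh_p_gt1.
have hiE (x a : R) : 0 < x < L ->
    (sin_p p x / x < 1 / cosh_p p x `^ a) = (a < g x).
  move=> /[dup] /s01 /andP[sx _] /andP[x0 _].
  by rewrite lt_ln_quotient// cosh_p_gt1.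
split => [//|x xL|a ha|b hb].
- by rewrite loE// hiE// g_lt// g_gt.
(* An admissible [a] lies below [g] on the whole interval, hence below its limit at 0; dually for
   [b] and the limit at [L]. *)
- apply: (cvgr_to_ge g_cvg0); near=> x.
  have xL : 0 < x < L.
    by apply/andP; split; near: x; [exact: nbhs_right_gt|exact: nbhs_right_lt].
  by rewrite ltW// -hiE// ha.
- apply: (cvgr_to_le g_cvgL); near=> x.
  have xL : 0 < x < L.
    by apply/andP; split; near: x; [exact: nbhs_left_gt|exact: nbhs_left_lt].
  by rewrite ltW// -loE// hb.
Unshelve. all: by end_near. Qed.
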